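(* Let $O,A,B$ be three pairwise distinct points of the plane. Let $l_1,l_2,l_3$ be polygonal lines joining $A$ to $B$ (each with first point $A$ and last point $B$) and not passing through $O$. Then $$w(l_1l_2^{-1},O)+w(l_2l_3^{-1},O)=w(l_1l_3^{-1},O).$$
   Context: All points are in the plane $\mathbb{R}^2$. For points $A,B\neq O$ (possibly $A=B$), the oriented angle $\angle AOB$ is the number $t\in(-\pi,\pi]$ such that $\overrightarrow{OB}$ is a positive multiple of the vector obtained from $\overrightarrow{OA}$ by counterclockwise rotation through $t$. A polygonal line $A_1\ldots A_m$ is an ordered tuple of points, not necessarily distinct; it does not pass through $O$ if $O$ is not on the union of the segments $A_iA_{i+1}$, $1\le i\le m-1$. A closed polygonal line $A_1\ldots A_m$ is also an ordered tuple of points, but the segment $A_mA_1$ is included in the union. The winding number of a closed polygonal line $l=A_1\ldots A_m$ around a point $O$ not on it is $w(l,O):=\frac{1}{2\pi}\sum_{i=1}^{m}\angle A_iOA_{i+1}$, where $A_{m+1}:=A_1$. The line $l^{-1}$ is $l$ traversed in the opposite order. The concatenation of $l_1=A_1\ldots A_mC$ and $l_2=CB_1\ldots B_k$ is $l_1l_2:=A_1\ldots A_mCB_1\ldots B_k$. For $i,j\in\{1,2,3\}$, the concatenation $l_il_j^{-1}$ starts and ends at $A$ and is regarded as a closed polygonal line (repeating the point $A$ at the end does not change the winding number). *)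

(* Defs.v *)
From mathcomp Require Import all_boot all_order all_algebra.
From mathcomp Require Import all_classical all_reals all_analysis.

Set Implicit Arguments.
Unset Strict Implicit.
Unset Printing Implicit Defensive.

Import Order.TTheory GRing.Theory Num.Theory.
Import numFieldNormedType.Exports.

Local Open Scope classical_set_scope.
Local Open Scope ring_scope.

Definition ccw_rotate (R : realType) (t : R) (v : R * R) : R * R :=
  (cos t * v.1 - sin t * v.2, sin t * v.1 + cos t * v.2).

Definition is_angle (R : realType) (A O B : R * R) (t : R) : Prop :=
  [/\ - pi < t, t <= pi & exists2 k : R, 0 < k & B - O = k *: ccw_rotate t (A - O)].

(* The number t with [is_angle A O B t], which exists and is unique when
   A, B <> O; the default value 0 of [xget] is irrelevant in that case. *)
Definition angle (R : realType) (A O B : R * R) : R :=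
  xget 0 [set t | is_angle A O B t].

Definition segment (R : realType) (A B : R * R) : set (R * R) :=
  [set P | exists2 s : R, 0 <= s <= 1 & P = (1 - s) *: A + s *: B].

(* A polygonal line A_1 ... A_m is the sequence of its vertices; the default
   value of [nth] is never reached below. *)
Definition avoids (R : realType) (l : seq (R * R)) (O : R * R) : Prop :=
  forall i : nat, (i.+1 < size l)%N -> ~ segment (nth O l i) (nth O l i.+1) O.

Definition joins (R : realType) (l : seq (R * R)) (A B : R * R) : Prop :=
  exists2 l', l = A :: l' & last A l' = B.

(* The last vertex of [l1] is meant to be the first one of [l2], and is kept
   only once. The inverse line of [l] is [rev l]. *)
Definition concat (R : realType) (l1 l2 : seq (R * R)) : seq (R * R) :=
  l1 ++ behead l2.

(* [l] is read as a closed line: the index is taken modulo [size l], so that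
   the vertex following the last one is the first one. *)
Definition winding (R : realType) (l : seq (R * R)) (O : R * R) : R :=
  (2 * pi)^-1 *
  \sum_(i < size l) angle (nth O l i) O (nth O l (i.+1 %% size l)).

(* Main.v *)
Require Import Defs.
From mathcomp Require Import all_boot all_order all_algebra.
From mathcomp Require Import all_classical all_reals all_analysis.
From mathcomp Require Import ring lra.

(** Let S(l) be the sum of the oriented angles at O along an open line l.  Since
   the edges of l avoid O, none of these angles is pi, so each changes sign when
   its edge is reversed, and S(l^-1) = - S(l).  The only extra term of the closed
   line l l'^-1 is the angle AOA = 0, so 2 pi w(l l'^-1) = S(l) - S(l'), and the
   theorem is a telescoping identity. *)

Set Implicit Arguments.
Unset Strict Implicit.
Unset Printing Implicit Defensive.

Import Order.TTheory GRing.Theory Num.Theory.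

Local Open Scope ring_scope.

Lemma sin_eq0_lt_pi (R : realType) (u : R) :
  - pi < u -> u < pi -> sin u = 0 -> u = 0.
Proof.
move=> u_gt u_lt su0; case: (ltgtP u 0) => // hu.
  have: 0 < sin (- u) by apply: sin_gt0_pi; rewrite oppr_gt0 hu /= ltrNl.
  by rewrite sinN su0 oppr0 ltxx.
by have := @sin_gt0_pi _ u; rewrite hu u_lt su0 ltxx => /(_ isT).
Qed.

(** The subtraction formula gives [cos (t - u) = 1], so the half-difference [h] has sine 0; as [h]
    lies strictly between [- pi] and [pi], it vanishes. *)
Lemma cos_sin_inj (R : realType) (t u : R) :
  - pi < t -> t <= pi -> - pi < u -> u <= pi ->
  cos t = cos u -> sin t = sin u -> t = u.
Proof.
move=> t1 t2 u1 u2 ec es.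
pose h := (t - u) / 2.
have ctu : cos (t - u) = 1 by rewrite cosB ec es -!expr2 cos2Dsin2.
have sh2 : sin h * sin h = 0.
  have e : t - u = h + h by rewrite /h; field.
  have := cos2Dsin2 h; move: ctu; rewrite e cosD !expr2 => *; lra.
have sh : sin h = 0 by move/eqP: sh2; rewrite mulf_eq0 orbb => /eqP.
have : h = 0 by apply: sin_eq0_lt_pi => //; rewrite /h; lra.
by rewrite /h; lra.
Qed.

Lemma ccw_rotateK (R : realType) (t : R) (v : R * R) :
  ccw_rotate (- t) (ccw_rotate t v) = v.
Proof.
rewrite /ccw_rotate cosN sinN /=; case: v => a b /=.
have e : cos t * cos t = 1 - sin t * sin t.
  by rewrite -(cos2Dsin2 t) !expr2 addrK.
by congr pair; ring: e.
Qed.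

Lemma ccw_rotateZ (R : realType) (t k : R) (v : R * R) :
  ccw_rotate t (k *: v) = k *: ccw_rotate t v.
Proof. by congr pair; rewrite /= /GRing.scale /=; ring. Qed.

(** With vectors read as complex numbers, dividing by the nonzero [A - O] leaves k e^(it) = m
    e^(iu); comparing moduli, then arguments, gives [k = m] and [t = u]. *)
Lemma is_angle_uniq (R : realType) (A O B : R * R) (t u : R) :
  A <> O -> is_angle A O B t -> is_angle A O B u -> t = u.
Proof.
move=> AO [t1 t2 [k k0 e]] [u1 u2 [m m0]]; rewrite {}e.
have : (A - O).1 != 0 \/ (A - O).2 != 0.
  apply/orP; rewrite -negb_and; apply/negP => /andP[/eqP a0 /eqP b0].
  by apply: AO; apply/eqP; rewrite -subr_eq0; apply/eqP/pair_equal_spec.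
case: (A - O) => a b /= ab0 []; rewrite /GRing.scale /= => e1 e2.
have n0 : a * a + b * b != 0.
  rewrite paddr_eq0 -?expr2 ?sqr_ge0// !sqrf_eq0 negb_and.
  by case: ab0 => ->; rewrite ?orbT.
have ec : k * cos t = m * cos u.
  (* Real part of the product of [B - O] with the conjugate of a + ib; the imaginary part serves for
     the sines below. *)
  apply: (mulIf n0); transitivity (a * (k * (cos t * a - sin t * b))
    + b * (k * (sin t * a + cos t * b))); first ring.
  by rewrite e1 e2; ring.
have es : k * sin t = m * sin u.
  apply: (mulIf n0); transitivity (a * (k * (sin t * a + cos t * b))
    - b * (k * (cos t * a - sin t * b))); first ring.
  by rewrite e1 e2; ring.
have km : k = m.
  apply/eqP; rewrite -(@eqrXn2 _ 2) ?ltW//; apply/eqP.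
  rewrite -[LHS]mulr1 -[RHS]mulr1 -{1}(cos2Dsin2 t) -(cos2Dsin2 u).
  by rewrite !mulrDr -!exprMn ec es.
have k_neq0 : k != 0 by rewrite gt_eqF.
by apply: cos_sin_inj => //; apply: (mulfI k_neq0); rewrite ?ec ?es km.
Qed.

Lemma angle_eq (R : realType) (A O B : R * R) (t : R) :
  A <> O -> is_angle A O B t -> angle A O B = t.
Proof.
move=> AO At; rewrite /angle; case: xgetP => [u _ Au | /(_ t)//].
exact: is_angle_uniq AO Au At.
Qed.

Lemma angle_refl (R : realType) (A O : R * R) : A <> O -> angle A O A = 0.
Proof.
move=> AO; apply: angle_eq => //; split; rewrite ?oppr_lt0 ?pi_gt0 ?pi_ge0//.
exists 1 => //; rewrite scale1r /ccw_rotate cos0 sin0; case: (A - O) => a b /=.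
by congr pair; ring.
Qed.

Lemma segmentC (R : realType) (A B P : R * R) : segment A B P -> segment B A P.
Proof.
move=> [s s01 ->]; exists (1 - s); first lra.
by rewrite subKr addrC.
Qed.

Lemma is_angle_pi_segment (R : realType) (A O B : R * R) :
  is_angle A O B pi -> segment A B O.
Proof.
move=> [_ _ [k k0]]; case: A O B => [a1 a2] [c d] [b1 b2] [] /=.
rewrite cospi sinpi /GRing.scale /= => e1 e2.
have k1 : 0 < k + 1 by lra.
(* Here B - O = -k (A - O), hence O = (k A + B) / (k + 1). *)
exists (k + 1)^-1.
  by rewrite invr_ge0 ltW //= invf_le1 //; lra.
have k1n : k + 1 != 0 by rewrite gt_eqF.
congr pair; rewrite /= /GRing.scale /=; apply: (mulfI k1n).
  have -> : b1 = c + k * (-1 * (a1 - c) - 0 * (a2 - d)) by rewrite -e1; ring.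
  by field.
have -> : b2 = d + k * (0 * (a1 - c) + -1 * (a2 - d)) by rewrite -e2; ring.
by field.
Qed.

(** In the half-open range of angles only [pi] has its opposite outside, and [pi] would put [O] on
    the segment. *)
Lemma is_angleN (R : realType) (A O B : R * R) (t : R) :
  ~ segment A B O -> is_angle A O B t -> is_angle B O A (- t).
Proof.
move=> ABO At; have tpi : t != pi.
  by apply/eqP => tpi; apply: ABO; apply: is_angle_pi_segment; rewrite -tpi.
case: At => t1 t2 [k k0 e].
have t3 : t < pi by rewrite lt_neqAle tpi.
split; [lra|lra|]; exists k^-1; rewrite ?invr_gt0//.
by rewrite e ccw_rotateZ ccw_rotateK scalerA mulVf ?gt_eqF ?scale1r.
Qed.

Lemma segmentl (R : realType) (A B : R * R) : segment A B A.
Proof. by exists 0; [lra|rewrite subr0 scale1r scale0r addr0]. Qed.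

Lemma angleC (R : realType) (A O B : R * R) :
  ~ segment A B O -> angle B O A = - angle A O B.
Proof.
move=> ABO; have BAO : ~ segment B A O by move/segmentC.
have BO : B <> O by move=> e; apply: BAO; rewrite e; exact: segmentl.
rewrite [in RHS]/angle; case: xgetP => [t _ At | noA].
  by apply: angle_eq => //; exact: is_angleN.
(* Without an angle from [A] to [B], the right side is the default 0. So is the left side, since an
   angle from [B] to [A] could be negated. *)
rewrite oppr0 /angle; case: xgetP => // t _ Bt.
by case: (noA (- t)); exact: is_angleN.
Qed.

(** The sum S of the open line [P :: s]; the separate first vertex lets the recursion carry the
    current point. *)
Fixpoint turning (R : realType) (O P : R * R) (s : seq (R * R)) : R :=
  if s is Q :: s' then angle P O Q + turning O Q s' else 0.

Lemma turning_cat (R : realType) (O P : R * R) (s1 s2 : seq (R * R)) :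
  turning O P (s1 ++ s2) = turning O P s1 + turning O (last P s1) s2.
Proof.
elim: s1 P => [|Q s1 IH] P /=; first by rewrite add0r.
by rewrite IH addrA.
Qed.

Lemma turning_sum (R : realType) (O P : R * R) (s : seq (R * R)) :
  turning O P s
    = \sum_(i < size s) angle (nth O (P :: s) i) O (nth O (P :: s) i.+1).
Proof.
elim: s P => [|Q s IH] P /=; first by rewrite big_ord0.
by rewrite big_ord_recl IH.
Qed.

Lemma winding_turning (R : realType) (O P : R * R) (s : seq (R * R)) :
  winding (P :: s) O
    = (2 * pi)^-1 * (turning O P s + angle (last P s) O P).
Proof.
rewrite /winding turning_sum [size (P :: s)]/= big_ord_recr; congr (_ * (_ + _)).
  by apply: eq_bigr => i _; rewrite modn_small//= ltnS ltn_ord.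
(* In the last term the index wraps around to 0, which gives the closing angle from [last P s] back
   to [P]. *)
by rewrite modnn nth0 -[X in nth O _ X]/((size (P :: s)).-1) nth_last.
Qed.

Lemma avoids_cons2 (R : realType) (O P Q : R * R) (s : seq (R * R)) :
  avoids (P :: Q :: s) O -> ~ segment P Q O /\ avoids (Q :: s) O.
Proof. by move=> H; split=> [|i hi]; [exact: (H 0%N)|exact: (H i.+1)]. Qed.

(** The line [last P s :: rev (belast P s)] is the reverse of [P :: s], split at its first vertex as
    [turning] requires. *)
Lemma turning_rev (R : realType) (O P : R * R) (s : seq (R * R)) :
  avoids (P :: s) O ->
  turning O (last P s) (rev (belast P s)) = - turning O P s.
Proof.
elim: s P => [|Q s IH] P /=; first by rewrite oppr0.
move=> /avoids_cons2[PQ /IH {}IH].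
rewrite rev_cons -cats1 turning_cat IH /=.
(* The reversed tail ends at [Q], so the one remaining edge runs from [Q] to [P]. *)
have -> : last (last Q s) (rev (belast Q s)) = Q.
  have -> : last (last Q s) (rev (belast Q s)) = last O (rev (Q :: s)).
    by rewrite lastI rev_rcons.
  by rewrite rev_cons last_rcons.
by rewrite angleC// addr0 opprD addrC.
Qed.

Lemma winding_concat_rev (R : realType) (O A B : R * R) (l1 l2 : seq (R * R)) :
  A <> O -> joins l1 A B -> joins l2 A B -> avoids l2 O ->
  winding (concat l1 (rev l2)) O
    = (2 * pi)^-1 * (turning O A (behead l1) - turning O A (behead l2)).
Proof.
move=> AO [s1 -> e1] [s2 -> e2] av2; rewrite /concat.
(* The head [B] of the reversed line is the vertex that [concat] drops; its last vertex is [A], so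
   the closing angle is that of [A] with itself. *)
have erev : rev (A :: s2) = B :: rev (belast A s2) by rewrite lastI rev_rcons e2.
have elast : last B (rev (belast A s2)) = A.
  by rewrite -[LHS]/(last O (B :: _)) -erev rev_cons last_rcons.
rewrite erev cat_cons winding_turning last_cat /= e1 elast angle_refl// addr0.
by rewrite turning_cat e1 -e2 turning_rev.
Qed.

Theorem mainTheorem2 (R : realType) (O A B : R * R)
    (hOA : O <> A) (hOB : O <> B) (hAB : A <> B)
    (l1 l2 l3 : seq (R * R))
    (hl1 : joins l1 A B) (hl2 : joins l2 A B) (hl3 : joins l3 A B)
    (hO1 : avoids l1 O) (hO2 : avoids l2 O) (hO3 : avoids l3 O) :
  winding (concat l1 (rev l2)) O + winding (concat l2 (rev l3)) O
    = winding (concat l1 (rev l3)) O.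
Proof.
have AO : A <> O by move=> e; apply: hOA.
rewrite (winding_concat_rev AO hl1 hl2)//.
rewrite (winding_concat_rev AO hl2 hl3)//.
rewrite (winding_concat_rev AO hl1 hl3)//.
by rewrite -mulrDr addrA subrK.
Qed.
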